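(* There exist a constant $c>0$, an infinite set $N$ of positive integers, and graphs $H_n$ ($n\in N$) such that $H_n$ has $n$ vertices, $\Theta(H_n)\le 3$, and $n_{\ge 0}(H_n)\ge c\,n^{1/12}$.
   Context: $\Theta(G)$ is the Shannon capacity $\Theta(G)=\sup_{k\ge1}\alpha(G^{\boxtimes k})^{1/k}$, where $\alpha$ is the independence number and $G^{\boxtimes k}$ the $k$-fold strong product of $G$. A weighted adjacency matrix of a graph $G=(V,E)$ is a Hermitian matrix $A$ indexed by $V$ with $A_{ij}\neq0$ only if $ij\in E$. For a Hermitian matrix $X$, $n_{\ge 0}(X)$ is its number of nonnegative eigenvalues (with multiplicity), and $n_{\ge 0}(G)$ is the minimum of $n_{\ge 0}(A)$ over all weighted adjacency matrices $A$ of $G$. *)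

(* Defs.v *)
From Stdlib Require Import Reals.
From HB Require Import structures.
From mathcomp Require Import all_boot all_order all_algebra.
From mathcomp Require Import boolp classical_sets reals Rstruct complex.

Set Implicit Arguments.
Unset Strict Implicit.
Unset Printing Implicit Defensive.

Import Order.TTheory GRing.Theory Num.Theory.

Definition simple_graph (T : finType) (e : rel T) : Prop :=
  symmetric e /\ irreflexive e.

Definition strong_pow (T : finType) (e : rel T) (k : nat)
  : rel {ffun 'I_k -> T} :=
  fun u v => (u != v) && [forall i, (u i == v i) || e (u i) (v i)].

Arguments strong_pow {T} e k.

Definition independent (T : finType) (e : rel T) (S : {set T}) : bool :=
  [forall x in S, forall y in S, ~~ e x y].

Definition alpha (T : finType) (e : rel T) : nat :=
  \max_(S : {set T} | independent e S) #|S|.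

Definition shannon_capacity (T : finType) (e : rel T) : R :=
  sup [set x : R | exists k : nat, (0 < k)%N /\
        x = Rpower (INR (alpha (strong_pow e k))) (Rinv (INR k))]%classic.

Local Open Scope ring_scope.

Notation C := (R[i]).

Definition hermitian (n : nat) (A : 'M[C]_n) : Prop :=
  forall i j, A j i = (A i j)^*.

Definition weighted_adj (n : nat) (e : rel 'I_n) (A : 'M[C]_n) : Prop :=
  hermitian A /\ (forall i j, A i j != 0 -> e i j).

(* eigenvalues of A with multiplicity: the roots of the characteristic polynomial
   (which is monic, and splits over the algebraically closed field C) *)
Definition eigenvalues (n : nat) (A : 'M[C]_n) : seq C :=
  sval (closed_field_poly_normal (char_poly A)).

Definition n_nonneg (n : nat) (A : 'M[C]_n) : nat :=
  count (fun x : C => 0 <= x) (eigenvalues A).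

Lemma weighted_adj0 (n : nat) (e : rel 'I_n) : weighted_adj e 0.
Proof. split; first by move=> i j; rewrite !mxE conjC0. by move=> i j; rewrite mxE eqxx. Qed.

Lemma n_nonneg_graph_ex (n : nat) (e : rel 'I_n) :
  exists m, `[< exists A : 'M[C]_n, weighted_adj e A /\ n_nonneg A = m >].
Proof. by exists (n_nonneg (0 : 'M[C]_n)); apply/asboolP; exists 0; split => //; apply: weighted_adj0. Qed.

Definition n_nonneg_graph (n : nat) (e : rel 'I_n) : nat :=
  ex_minn (n_nonneg_graph_ex e).

(* Main.v *)
Require Import Defs.
From Stdlib Require Import Reals.
From mathcomp Require Import all_boot all_order all_algebra.
From mathcomp Require Import perm spectral sesquilinear ring lra.
From mathcomp Require Import boolp classical_sets reals Rstruct complex.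

(* The vertices of the graph are the pairs x = (a, b) in F_p x F_p with
   a^2 <> 2 b, and x, y are adjacent unless x = y or x.1 y.1 = x.2 + y.2. The
   matrix x.1 y.1 - x.2 - y.2 over F_p has rank at most 3, a nonzero diagonal,
   and vanishes on nonadjacent pairs, so Haemers' bound gives capacity <= 3.

   For the inertia, let A be a weighted adjacency matrix with k nonnegative
   eigenvalues; pass to a nonsingular principal submatrix. Among the scalings
   X = D A D (D positive diagonal) with X <= I choose one that maximizes
   |det X|^2 det(I - X) up to a factor 2. Comparing with the scalings of a
   single coordinate by 2 and 1/2 shows that M = (I - X)^-1 has diagonal
   entries in [5/4, 43]; in particular tr(M X) = tr(M - I) >= r/4, r the size.
   As tr X = 0 and X <= I has at most k positive eigenvalues, the trace norm of
   X is at most 2k. Let B be the adjacency matrix of the polarity relation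
   x.1 y.1 = x.2 + y.2, and R = B - J/p, which has norm at most sqrt p. Since
   X vanishes where B does not, <R o M, X> = - tr(M X) / p, while the Schur
   product R o M has norm at most 43 sqrt p. Hence r/(4p) <= 86 k sqrt p, and
   k is at least of order sqrt p, that is n^(1/4). *)

Set Implicit Arguments.
Unset Strict Implicit.
Unset Printing Implicit Defensive.
Import Order.TTheory GRing.Theory Num.Theory.
Local Open Scope ring_scope.
Local Open Scope sesquilinear_scope.

(** * Hermitian forms and spectral decomposition *)

Section HermitianForms.
Variable C : numClosedFieldType.

Definition qform n (X : 'M[C]_n) (x : 'rV[C]_n) : C := (x *m X *m x ^t*) 0 0.

Lemma adjmxM m n p (A : 'M[C]_(m, n)) (B : 'M[C]_(n, p)) :
  (A *m B)^t* = B^t* *m A^t*.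
Proof. by rewrite trmx_mul map_mxM. Qed.

Lemma qform_congr m n (B : 'M[C]_(m, n)) (X : 'M[C]_n) x :
  qform (B *m X *m B^t*) x = qform X (x *m B).
Proof. by rewrite /qform adjmxM !mulmxA. Qed.

Lemma qform_diag n (l : 'rV[C]_n) x :
  qform (diag_mx l) x = \sum_i l 0 i * `|x 0 i| ^+ 2.
Proof.
rewrite /qform mxE; apply: eq_bigr => i _.
by rewrite mul_mx_diag !mxE normCK -mulrA mulrCA mulrA.
Qed.

Lemma qformE n (X : 'M[C]_n) x :
  qform X x = \sum_i \sum_j x 0 i * X i j * (x 0 j)^*.
Proof.
rewrite /qform mxE exchange_big; apply: eq_bigr => j _.
by rewrite !mxE mulr_suml.
Qed.

Lemma qform1 n (x : 'rV[C]_n) : qform 1%:M x = \sum_i `|x 0 i| ^+ 2.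
Proof.
rewrite -diag_const_mx qform_diag; apply: eq_bigr => i _.
by rewrite mxE mul1r.
Qed.

Lemma herm_spectral n (X : 'M[C]_n) : X^t* = X ->
  exists U (l : 'rV[C]_n),
    [/\ U *m U^t* = 1%:M, U^t* *m U = 1%:M, (forall i, l 0 i \is Num.real)
      & X = U^t* *m diag_mx l *m U].
Proof.
move=> hX.
have hX' : X \is hermsymmx.
  by apply/is_hermitianmxP; rewrite expr0 scale1r hX.
have Uu := spectral_unitarymx X.
exists (spectralmx X), (spectral_diag X); split.
- exact/unitarymxP.
- by rewrite -invmx_unitary // mulVmx // spectral_unit.
- by move=> i; have /mxOverP := hermitian_spectral_diag_real hX'; apply.
- rewrite -invmx_unitary //; apply/orthomx_spectralP.
  exact: hermitian_normalmx.
Qed.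

(* Stands for at most k positive eigenvalues, in a form for which stability
   under congruence is immediate. *)
Definition nonpos_codim (k : nat) n (X : 'M[C]_n) :=
  exists V : 'M[C]_(n, k), forall x, x *m V = 0 -> qform X x <= 0.

Lemma nonpos_codim_congr k m n (B : 'M[C]_(m, n)) (X : 'M[C]_n) :
  nonpos_codim k X -> nonpos_codim k (B *m X *m B^t*).
Proof.
by case=> V hV; exists (B *m V) => x; rewrite qform_congr mulmxA; apply: hV.
Qed.

(** The form is positive definite on the span of the eigenvectors with positive eigenvalue, so this
    span meets the kernel of [V] only in 0; and [V] has rank at most [k]. *)
Lemma card_pos_le k n (U : 'M[C]_n) (l : 'rV[C]_n) :
  U *m U^t* = 1%:M -> nonpos_codim k (U^t* *m diag_mx l *m U) ->
  (#|[set i | (0 < l 0 i)%R]| <= k)%N.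
Proof.
move=> UU [V hV]; set S := [set i | _]; rewrite leqNgt; apply/negP => kS.
pose E : 'M[C]_(#|S|, n) := \matrix_(a, i) (i == enum_val a)%:R.
pose W := E *m U *m V.
have : \rank (kermx W) != 0%N.
  by rewrite mxrank_ker subn_eq0 -ltnNge (leq_ltn_trans (rank_leq_col _)).
rewrite mxrank_eq0 => /rowV0Pn[c /sub_kermxP cW c0].
have := hV (c *m E *m U).
rewrite /W !mulmxA in cW; rewrite -!mulmxA !mulmxA cW => /(_ erefl).
rewrite -[X in _ *m X]trmxCK qform_congr -!mulmxA UU mulmx1 qform_diag.
have cE a : (c *m E) 0 (enum_val a) = c 0 a.
  rewrite mxE (bigD1 a) //= mxE eqxx mulr1 big1 ?addr0 // => b ba.
  by rewrite mxE (inj_eq enum_val_inj) eq_sym (negbTE ba) mulr0.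
have cE0 i : i \notin S -> (c *m E) 0 i = 0.
  move=> iS; rewrite mxE big1 // => b _; rewrite mxE.
  case: eqP => [e|]; last by rewrite mulr0.
  by rewrite e enum_valP in iS.
have ge0 i : 0 <= l 0 i * `|(c *m E) 0 i| ^+ 2.
  have [iS|iS] := boolP (i \in S); last by rewrite cE0 // normr0 expr0n mulr0.
  by rewrite mulr_ge0 ?exprn_ge0 // ltW //; move: iS; rewrite inE.
case/rV0Pn: c0 => a ca.
rewrite (bigD1 (enum_val a)) //= cE => h.
have: 0 < l 0 (enum_val a) * `|c 0 a| ^+ 2.
  rewrite mulr_gt0 ?exprn_gt0 ?normr_gt0 //.
  by have := enum_valP a; rewrite inE.
by move/lt_geF; rewrite (le_trans _ h) // lerDl sumr_ge0.
Qed.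


Lemma char_poly_unitary_diag n (U : 'M[C]_n) (l : 'rV[C]_n) :
  U^t* *m U = 1%:M ->
  char_poly (U^t* *m diag_mx l *m U) = \prod_(i < n) ('X - (l 0 i)%:P).
Proof.
move=> UU.
transitivity (char_poly (diag_mx l)); last first.
  rewrite char_poly_trig ?diag_mx_is_trig //.
  by apply: eq_bigr => i _; rewrite mxE eqxx mulr1n.
have PP : map_mx polyC (U^t*) *m map_mx polyC U = 1%:M.
  by rewrite -map_mxM UU map_mx1.
rewrite /char_poly.
have -> : char_poly_mx (U^t* *m diag_mx l *m U) =
  map_mx polyC (U^t*) *m char_poly_mx (diag_mx l) *m map_mx polyC U.
  rewrite /char_poly_mx mulmxBr mulmxBl -!map_mxM; congr (_ - _).
  by rewrite mul_mx_scalar -scalemxAl PP scalemx1.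
by rewrite !det_mulmx mulrAC -det_mulmx PP det1 mul1r.
Qed.

(** The witness [V] has as columns the eigenvectors of nonnegative eigenvalue; a vector orthogonal
    to them has only negative components. Since zero eigenvalues are counted, [V] is also injective
    on the kernel of [A], which controls the rank lost on passing to a nonsingular submatrix. *)
Lemma nonneg_roots_codim n (A : 'M[C]_n) (s : seq C) : A^t* = A ->
  char_poly A = \prod_(x <- s) ('X - x%:P) ->
  let k := count (fun x => 0 <= x) s in
  nonpos_codim k A /\ (n - \rank A <= k)%N.
Proof.
move=> hA hs k.
have [U [l [UU UU' lr eA]]] := herm_spectral hA.
set S := [set i | 0 <= l 0 i].
have kS : k = #|S|.
  (* By unique factorization [s] is a permutation of the diagonal [l]. *)
  rewrite eA char_poly_unitary_diag // in hs.
  have /prod_XsubC_eq/seq.permP/(_ (fun x => 0 <= x)) :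
      \prod_(x <- s) ('X - x%:P) = \prod_(x <- [seq l 0 i | i <- enum 'I_n]) ('X - x%:P).
    by rewrite -hs big_map big_enum.
  rewrite /k => ->; rewrite -sum1_count big_map big_enum_cond -sum1_card /=.
  by apply: eq_bigl => i; rewrite inE.
pose V : 'M[C]_(n, #|S|) := colsub enum_val (U^t*).
have hV (x : 'rV_n) : x *m V = 0 -> forall i, 0 <= l 0 i -> (x *m U^t*) 0 i = 0.
  move=> xV i li; have iS : i \in S by rewrite inE.
  have := congr1 (fun M : 'rV_#|S| => M 0 (enum_rank_in iS i)) xV.
  by rewrite mulmx_colsub !mxE enum_rankK_in.
rewrite kS; split.
  exists V => x xV; rewrite eA -{2}[U]trmxCK qform_congr qform_diag.
  rewrite -oppr_ge0 -sumrN; apply: sumr_ge0 => i _.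
  have [li|li] := boolP (0 <= l 0 i); first by rewrite hV // normr0 expr0n mulr0 oppr0.
  rewrite -mulNr mulr_ge0 ?exprn_ge0 // oppr_ge0.
  by rewrite ltW // real_ltNge // real0.
rewrite -mxrank_ker -(mxrank_mul_ker (kermx A) V).
suff -> : (kermx A :&: kermx V)%MS = 0 by rewrite mxrank0 addn0 rank_leq_col.
apply/eqP/rowV0P => x; rewrite sub_capmx => /andP[/sub_kermxP xA /sub_kermxP xV].
suff xU : x *m U^t* = 0 by rewrite -[x]mulmx1 -UU' mulmxA xU mul0mx.
apply/rowP => i; rewrite [RHS]mxE.
have [li|li] := boolP (0 <= l 0 i); first exact: hV.
have : (x *m A *m U^t*) 0 i = 0 by rewrite xA mul0mx mxE.
rewrite eA -!mulmxA UU mulmx1 !mulmxA mul_mx_diag mxE => /eqP.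
by rewrite mulf_eq0 => /orP[/eqP //|/eqP l0]; rewrite l0 lexx in li.
Qed.

(* For a Hermitian matrix the rows of a row basis and the columns with the same
   indices span the row and the column space. *)
Lemma herm_principal_unit n (A : 'M[C]_n) : A^t* = A ->
  exists2 f : 'I_(\rank A) -> 'I_n, injective f & mxsub f f A \in unitmx.
Proof.
move=> hA; exists (maxrankfun A); first exact: maxrankfun_inj.
set f := maxrankfun A; set B := rowsub f A.
have /submxP [M eM] : (A <= B)%MS by rewrite eq_maxrowsub.
have rB : \rank B = \rank A by rewrite /B eq_maxrowsub.
have eB : B = mxsub f f A *m M^t*.
  have eA : A = B^t* *m M^t* by rewrite -adjmxM -eM hA.
  transitivity (rowsub f (B^t* *m M^t*)); first by rewrite -eA.
  rewrite -mul_rowsub_mx; congr (_ *m _).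
  apply/matrixP => i j; rewrite !mxE.
  by move/matrixP/(_ (f i) (f j)): hA; rewrite !mxE.
rewrite -row_full_unit /row_full eqn_leq rank_leq_row /=.
by rewrite -[X in (X <= _)%N]rB {1}eB mxrankM_maxl.
Qed.

(** * Scaling one coordinate *)

Lemma qformB n (A B : 'M[C]_n) x : qform (A - B) x = qform A x - qform B x.
Proof. by rewrite /qform mulmxBr mulmxBl !mxE. Qed.

Lemma qform_delta n (A : 'M[C]_n) i : qform A (delta_mx 0 i) = A i i.
Proof.
rewrite qformE (bigD1 i) //= (bigD1 i) //= !mxE !eqxx conjC1 mul1r mulr1.
rewrite big1 ?addr0 ?big1 ?addr0 // => j ji.
  by rewrite big1 // => l _; rewrite !mxE (negbTE ji) andbF !mul0r.
by rewrite !mxE (negbTE ji) andbF conjC0 mulr0.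
Qed.

Lemma adj1mx n : (1%:M : 'M[C]_n)^t* = 1%:M.
Proof. by rewrite trmx1 map_mx1. Qed.

Lemma adjmxB m n (A B : 'M[C]_(m, n)) : (A - B)^t* = A^t* - B^t*.
Proof. by rewrite linearB /= map_mxB. Qed.

Lemma adjmxZ m n a (A : 'M[C]_(m, n)) : (a *: A)^t* = a^* *: A^t*.
Proof. by apply/matrixP => i j; rewrite !mxE rmorphM. Qed.

Lemma adj_invmx n (A : 'M[C]_n) : A^t* = A -> (invmx A)^t* = invmx A.
Proof. by move=> hA; rewrite trmx_inv map_invmx hA. Qed.

(** Expands the form at [y - c y_i e_i B^-1]. This is the Cauchy-Schwarz inequality
    [|y_i|^2 <= (B^-1)_ii B(y)] with the multiplier [c] left free. *)
Lemma qform_inv_ge n (B : 'M[C]_n) (y : 'rV[C]_n) (i : 'I_n) (c : C) :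
  B^t* = B -> (forall x, 0 <= qform B x) -> B \in unitmx -> c \is Num.real ->
  0 <= qform B y - 2 * c * `|y 0 i| ^+ 2
       + c ^+ 2 * invmx B i i * `|y 0 i| ^+ 2.
Proof.
move=> hB B0 uB rc; set M := invmx B.
have hM : M^t* = M by exact: adj_invmx.
pose d : 'rV[C]_n := delta_mx 0 i; pose d' : 'cV[C]_n := delta_mx i 0.
have hd : d^t* = d' by rewrite trmx_delta map_delta_mx.
set a := c * y 0 i.
have := B0 (y - a *: (d *m M)).
suff -> : qform B (y - a *: (d *m M)) =
   qform B y - a * (y 0 i)^* - a^* * y 0 i + a * a^* * M i i.
  rewrite /a rmorphM /= (CrealP rc) normCK.
  by move=> /le_trans; apply; rewrite le_eqVlt; apply/orP; left; apply/eqP; ring.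
rewrite /qform adjmxB.
have -> : (a *: (d *m M)) ^t* = a^* *: (M *m d').
  by rewrite adjmxZ adjmxM hM hd.
rewrite !mulmxBl !mulmxBr -!scalemxAl -!scalemxAr -?scalemxAl.
rewrite !mulmxA -(mulmxA _ M B) mulVmx // mulmx1.
rewrite -[y *m B *m M]mulmxA mulmxV // mulmx1.
have e1 : (d *m y^t* : 'M_1) 0 0 = (y 0 i)^*.
  by rewrite /d -rowE !mxE.
have e2 : (y *m d' : 'M_1) 0 0 = y 0 i.
  by rewrite /d' -colE !mxE.
have e3 : (d *m M *m d' : 'M_1) 0 0 = M i i.
  by rewrite /d /d' -rowE -colE !mxE.
have bE (A1 A2 : 'M[C]_1) : (A1 - A2) 0 0 = A1 0 0 - A2 0 0 by rewrite !mxE.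
have zE b (A1 : 'M[C]_1) : (b *: A1) 0 0 = b * A1 0 0 by rewrite !mxE.
rewrite !(bE, zE) e1 e2 e3; ring.
Qed.

Definition scalemx n (i : 'I_n) (s : C) : 'M[C]_n :=
  diag_mx (\row_j if j == i then s else 1).

Lemma scalemx_adj n (i : 'I_n) s : s \is Num.real ->
  (scalemx i s)^t* = scalemx i s.
Proof.
move=> /CrealP rs; rewrite /scalemx tr_diag_mx map_diag_mx.
by congr (diag_mx _); apply/rowP => j; rewrite !mxE; case: ifP => _; rewrite /= ?rs ?conjC1.
Qed.

Lemma det_scalemx n (i : 'I_n) s : \det (scalemx i s) = s.
Proof.
rewrite det_diag (bigD1 i) //= mxE eqxx big1 ?mulr1 // => j ji.
by rewrite mxE (negbTE ji).
Qed.

Lemma mulmx_scalemx n (x : 'rV[C]_n) (i : 'I_n) s j :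
  (x *m scalemx i s) 0 j = if j == i then s * x 0 j else x 0 j.
Proof. by rewrite mul_mx_diag !mxE; case: ifP => _; rewrite ?mulr1 // mulrC. Qed.

Lemma scalemx_congrE n (X : 'M[C]_n) (i : 'I_n) s j l :
  (scalemx i s *m X *m scalemx i s) j l =
  (if j == i then s else 1) * X j l * (if l == i then s else 1).
Proof. by rewrite mul_mx_diag mul_diag_mx !mxE. Qed.

(** Matrix determinant lemma for a rank one update: only row [i] changes, so its cofactors are those
    of [B]. *)
Lemma det_add_delta n (B : 'M[C]_n) (i : 'I_n) c : B \in unitmx ->
  \det (B + c *: delta_mx i i) = \det B * (1 + c * invmx B i i).
Proof.
move=> uB; rewrite /invmx uB !mxE.
have -> : \det B * (1 + c * ((\det B)^-1 * cofactor B i i)) =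
   \det B + c * cofactor B i i.
  rewrite unitmxE unitfE in uB; field; exact: uB.
rewrite (expand_det_row _ i) (expand_det_row B i).
have cE j : cofactor (B + c *: delta_mx i i) i j = cofactor B i j.
  rewrite /cofactor; congr (_ * \det _); apply/matrixP => a b; rewrite !mxE.
  by rewrite eq_sym (negbTE (neq_lift _ _)) /= mulr0 addr0.
have -> : c * cofactor B i i = \sum_j (c * (j == i)%:R) * cofactor B i j.
  rewrite (bigD1 i) //= eqxx mulr1 big1 ?addr0 // => j ji.
  by rewrite (negbTE ji) mulr0 mul0r.
rewrite -big_split; apply: eq_bigr => j _ /=.
by rewrite cE !mxE eqxx /= mulrDl.
Qed.

(** With [S] the scaling, [I - S X S = S (S^-2 - X) S], and [S^-2 - X] is a rank one update of
    [I - X]. *)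
Lemma det_scalemx_congr n (X : 'M[C]_n) (i : 'I_n) s : s != 0 ->
  1%:M - X \in unitmx ->
  \det (1%:M - scalemx i s *m X *m scalemx i s) =
  (s ^+ 2 + (1 - s ^+ 2) * invmx (1%:M - X) i i) * \det (1%:M - X).
Proof.
move=> s0 u.
have -> : 1%:M - scalemx i s *m X *m scalemx i s =
  scalemx i s *m (1%:M - X + (s ^- 2 - 1) *: delta_mx i i) *m scalemx i s.
  apply/matrixP => j l; rewrite [RHS]scalemx_congrE.
  rewrite [LHS]mxE [X in _ + X = _]mxE scalemx_congrE !mxE.
  case: (eqVneq j i) => [->|ji]; case: (eqVneq l i) => [->|li] /=;
    rewrite ?eqxx ?(negbTE ji) ?[i == l]eq_sym ?(negbTE li) /=; field; exact: s0.
rewrite !det_mulmx det_scalemx det_add_delta //; field; exact: s0.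
Qed.

(** * Admissible matrices and near-maximal potential *)

(** Here [b] is where [X] has to vanish: the polarity relation in the application, not the
    adjacency. The potential is nearly maximized over all such [X], so that the scaled matrix [A]
    need not be carried along. *)
Definition admissible k n (b : rel 'I_n) (X : 'M[C]_n) :=
  [/\ X^t* = X, forall i, X i i = 0, forall i j, b i j -> X i j = 0,
      nonpos_codim k X & forall x, 0 <= qform (1%:M - X) x].

Lemma qform_scalemx n (X : 'M[C]_n) (i : 'I_n) s x : s \is Num.real ->
  qform (1%:M - scalemx i s *m X *m scalemx i s) x =
  (1 - s ^+ 2) * `|x 0 i| ^+ 2 + qform (1%:M - X) (x *m scalemx i s).
Proof.
move=> rs; rewrite !qformB -{2}(scalemx_adj i rs) qform_congr addrA.
congr (_ - _); rewrite !qform1 (bigD1 i) //= [in RHS](bigD1 i) //=.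
rewrite mulmx_scalemx eqxx normrM exprMn (real_normK rs).
rewrite [in RHS](eq_bigr (fun j => `|x 0 j| ^+ 2)) => [|j ji]; first by ring.
by rewrite mulmx_scalemx (negbTE ji).
Qed.

Lemma scalemx_admissible k n b (X : 'M[C]_n) (i : 'I_n) s :
  s \is Num.real -> admissible k b X ->
  (forall x, 0 <= qform (1%:M - scalemx i s *m X *m scalemx i s) x) ->
  admissible k b (scalemx i s *m X *m scalemx i s).
Proof.
move=> rs [hX X0 Xb kX _] X1; split=> //.
- by rewrite !adjmxM hX scalemx_adj // mulmxA.
- by move=> j; rewrite scalemx_congrE X0 mulr0 mul0r.
- by move=> j l /Xb jl; rewrite scalemx_congrE jl mulr0 mul0r.
- by rewrite -{2}(scalemx_adj i rs); apply: nonpos_codim_congr.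
Qed.

Lemma herm1B n (X : 'M[C]_n) : X^t* = X -> (1%:M - X)^t* = 1%:M - X.
Proof. by move=> hX; rewrite adjmxB adj1mx hX. Qed.

Lemma det_unitary_congr n (U : 'M[C]_n) (B : 'M[C]_n) : U *m U^t* = 1%:M ->
  \det (U^t* *m B *m U) = \det B.
Proof.
by move=> UU; rewrite !det_mulmx mulrC mulrA -det_mulmx UU det1 mul1r.
Qed.

Lemma unitary_eigen n (U : 'M[C]_n) (l : 'rV[C]_n) i : U *m U^t* = 1%:M ->
  qform (U^t* *m diag_mx l *m U) (row i U) = l 0 i.
Proof.
move=> UU; rewrite -{2}[U]trmxCK qform_congr rowE -mulmxA UU mulmx1.
by rewrite qform_delta mxE eqxx mulr1n.
Qed.

Lemma psd_det_ge0 n (B : 'M[C]_n) : B^t* = B -> (forall x, 0 <= qform B x) ->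
  0 <= \det B.
Proof.
move=> hB B0; have [U [l [UU UU' lr eB]]] := herm_spectral hB.
rewrite eB det_unitary_congr // det_diag; apply: prodr_ge0 => i _.
by rewrite -(unitary_eigen l i UU) -eB.
Qed.

(** The first factor rewards large [X], the second keeps [X] away from the boundary of [X <= I]. At
    an exact maximizer, stationarity under scaling coordinate [i] would give [(I - X)^-1] the
    diagonal entry 3. *)
Definition potential n (X : 'M[C]_n) := `|\det X| ^+ 2 * \det (1%:M - X).

Lemma potential_ge0 k n b (X : 'M[C]_n) : admissible k b X -> 0 <= potential X.
Proof.
case=> hX _ _ _ X1; rewrite mulr_ge0 ?exprn_ge0 //.
by apply: psd_det_ge0 => //; apply: herm1B.
Qed.

Lemma qform_delta2 n (B : 'M[C]_n) (i j : 'I_n) (a : C) :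
  qform B (delta_mx 0 i + a *: delta_mx 0 j) =
  B i i + a^* * B i j + (a * B j i + a * a^* * B j j).
Proof.
rewrite /qform; set u : 'rV_n := delta_mx 0 i; set v : 'rV_n := delta_mx 0 j.
have -> : (u + a *: v)^t* = u^t* + a^* *: v^t*.
  by rewrite linearD /= map_mxD adjmxZ.
have uE : u^t* = delta_mx i 0 by rewrite trmx_delta map_delta_mx.
have vE : v^t* = delta_mx j 0 by rewrite trmx_delta map_delta_mx.
have E c d : ((delta_mx 0 c : 'rV_n) *m B *m (delta_mx d 0 : 'cV_n)) 0 0 = B c d.
  by rewrite -rowE -colE !mxE.
rewrite uE vE !mulmxDl !mulmxDr -!scalemxAl -!scalemxAr -?scalemxAl.
have dE (A1 A2 : 'M[C]_1) : (A1 + A2) 0 0 = A1 0 0 + A2 0 0 by rewrite !mxE.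
have zE e (A1 : 'M[C]_1) : (e *: A1) 0 0 = e * A1 0 0 by rewrite !mxE.
by rewrite !(dE, zE) /u /v !E; ring.
Qed.

Lemma admissible_entry k n b (X : 'M[C]_n) i j :
  admissible k b X -> `|X i j| <= 1.
Proof.
case=> hX X0 _ _ X1.
have [->|ij] := eqVneq i j; first by rewrite X0 normr0.
rewrite -(@expr_le1 _ 2) // -subr_ge0.
(* At this vector the form of [I - X] has the value [1 - |X i j|^2]. *)
have := X1 (delta_mx 0 i + X i j *: delta_mx 0 j).
suff -> : qform (1%:M - X) (delta_mx 0 i + X i j *: delta_mx 0 j) =
   1 - `|X i j| ^+ 2 by [].
have Xji : X j i = (X i j)^*.
  by move/matrixP/(_ j i): hX; rewrite !mxE => <-.
rewrite qform_delta2 !mxE !eqxx [j == i]eq_sym (negbTE ij) !X0 Xji normCK /=.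
ring.
Qed.

Lemma det_bound n (B : 'M[C]_n) c : (forall i j, `|B i j| <= c) ->
  `|\det B| <= n`!%:R * c ^+ n.
Proof.
move=> Bc; rewrite /determinant (le_trans (ler_norm_sum _ _ _)) //.
rewrite -card_Sn mulr_natl -sumr_const; apply: ler_sum => s _.
rewrite normrM normrX normrN1 expr1n mul1r normr_prod.
rewrite -[X in c ^+ X]card_ord -prodr_const; apply: ler_prod => i _.
by rewrite normr_ge0 Bc.
Qed.

Lemma potential_bound k n b (X : 'M[C]_n) : admissible k b X ->
  potential X <= n`!%:R ^+ 2 * (n`!%:R * 2 ^+ n).
Proof.
move=> aX; have X1 := admissible_entry _ _ aX.
rewrite -[potential X]ger0_norm ?(potential_ge0 aX) // normrM normrX normr_id.
apply: ler_pM; rewrite ?exprn_ge0 //.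
  rewrite ler_pXn2r ?nnegrE ?ler0n //.
  by have := det_bound X1; rewrite expr1n mulr1.
apply: det_bound => i j; rewrite !mxE (le_trans (ler_normB _ _)) //.
rewrite (_ : 2 = 1 + 1) // lerD //.
by case: eqP => _; rewrite ?normr1 ?normr0.
Qed.

(** Replaces compactness: if no such [X] existed, the potential could be doubled forever, against
    [potential_bound]. The field is abstract, so the Archimedean property is a hypothesis. *)
Lemma near_maximal k n b (X0 : 'M[C]_n) :
  (forall x : C, 0 <= x -> exists m : nat, x < m%:R) ->
  admissible k b X0 -> 0 < potential X0 ->
  exists X, [/\ admissible k b X, 0 < potential X &
    forall Y, admissible k b Y -> potential Y < 2 * potential X].
Proof.
move=> archi aX0 pX0; apply: contrapT => hN.
have step X : admissible k b X -> 0 < potential X ->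
    exists Y, admissible k b Y /\ 2 * potential X <= potential Y.
  move=> aX pX; apply: contrapT => hY; apply: hN; exists X; split=> // Y aY.
  have rX := ger0_real (potential_ge0 aX); have rY := ger0_real (potential_ge0 aY).
  have r2 : 2 * potential X \is Num.real by apply: realM; rewrite ?realn.
  rewrite (real_ltNge rY r2); apply/negP => h; apply: hY; by exists Y.
have grow m : exists X, admissible k b X /\ 2 ^+ m * potential X0 <= potential X.
  elim: m => [|m [X [aX hX]]]; first by exists X0; rewrite expr0 mul1r.
  have pX : 0 < potential X by rewrite (lt_le_trans _ hX) // mulr_gt0 ?exprn_gt0.
  have [Y [aY hY]] := step X aX pX; exists Y; split=> //.
  by rewrite (le_trans _ hY) // exprS -mulrA ler_pM2l.
set B := n`!%:R ^+ 2 * (n`!%:R * 2 ^+ n) : C.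
have B0 : 0 <= B by rewrite /B !mulr_ge0 ?exprn_ge0 ?ler0n.
have [|m hm] := archi (B / potential X0); first by rewrite divr_ge0 // ltW.
have [X [aX hX]] := grow m.
have : 2 ^+ m * potential X0 <= B := le_trans hX (potential_bound aX).
rewrite -ler_pdivlMr // => /le_lt_trans/(_ hm).
by rewrite -natrX ltr_nat ltnNge ltnW // ltn_expl.
Qed.

Lemma spectral_1B n (U : 'M[C]_n) (l : 'rV[C]_n) c : U^t* *m U = 1%:M ->
  1%:M - c *: (U^t* *m diag_mx l *m U) =
  U^t* *m diag_mx (\row_i (1 - c * l 0 i)) *m U.
Proof.
move=> UU; have -> : diag_mx (\row_i (1 - c * l 0 i)) = 1%:M - c *: diag_mx l.
  apply/matrixP => i j; rewrite !mxE.
  by case: eqP => _; rewrite ?mulr1n // !mulr0n mulr0 subr0.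
by rewrite mulmxBr mulmxBl mulmx1 UU -scalemxAr -scalemxAl.
Qed.

Lemma admissible_start k n (b : rel 'I_n) (A : 'M[C]_n) :
  A^t* = A -> (forall i, A i i = 0) -> (forall i j, b i j -> A i j = 0) ->
  nonpos_codim k A -> A \in unitmx ->
  exists X : 'M[C]_n, admissible k b X /\ 0 < potential X.
Proof.
move=> hA A0 Ab [V kA] uA; have [U [l [UU UU' lr eA]]] := herm_spectral hA.
(* This [c] brings every eigenvalue of [c *: A] strictly below 1. *)
pose s := \sum_i `|l 0 i|; pose c := (1 + s)^-1.
have s0 : 0 <= s by apply: sumr_ge0.
have s1 : 0 < 1 + s by rewrite ltr_pwDl.
have c0 : 0 < c by rewrite invr_gt0.
have cl i : 0 < 1 - c * l 0 i.
  rewrite subr_gt0 mulrC ltr_pdivrMr // mul1r.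
  rewrite (le_lt_trans (real_ler_norm (lr i))) // (@le_lt_trans _ _ s) ?ltrDr //.
  by rewrite /s (bigD1 i) //= lerDl sumr_ge0.
have e1 := spectral_1B l c UU'; rewrite -eA in e1.
exists (c *: A); split; first split.
- by rewrite adjmxZ hA (CrealP (gtr0_real c0)).
- by move=> i; rewrite mxE A0 mulr0.
- by move=> i j /Ab Aij; rewrite mxE Aij mulr0.
- exists V => x /kA; rewrite /qform -scalemxAr -scalemxAl [X in _ -> X <= _]mxE.
  by rewrite pmulr_rle0.
- move=> x; rewrite e1 -{2}[U]trmxCK qform_congr qform_diag.
  by apply: sumr_ge0 => i _; rewrite mxE mulr_ge0 ?exprn_ge0 // ltW.
rewrite /potential e1 det_unitary_congr // det_diag mulr_gt0 //.
  rewrite exprn_gt0 // normr_gt0 detZ mulf_neq0 ?expf_neq0 ?(lt0r_neq0 c0) //.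
  by move: uA; rewrite unitmxE unitfE.
by apply: prodr_gt0 => i _; rewrite mxE.
Qed.

Lemma potential_unitmx n (X : 'M[C]_n) : 0 < potential X ->
  1%:M - X \in unitmx.
Proof.
rewrite unitmxE unitfE => /lt0r_neq0; apply: contraNneq => e.
by rewrite /potential e mulr0.
Qed.

Lemma potential_scalemx n (X : 'M[C]_n) (i : 'I_n) s : 0 < s ->
  0 < potential X ->
  potential (scalemx i s *m X *m scalemx i s) =
  s ^+ 4 * (s ^+ 2 + (1 - s ^+ 2) * invmx (1%:M - X) i i) * potential X.
Proof.
move=> s0 /potential_unitmx u.
rewrite /potential det_scalemx_congr ?gt_eqF // !det_mulmx !det_scalemx.
by rewrite !normrM (gtr0_norm s0); ring.
Qed.

Lemma near_maximal_diag k n (b : rel 'I_n) (X : 'M[C]_n) (i : 'I_n) :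
  admissible k b X -> 0 < potential X ->
  (forall Y, admissible k b Y -> potential Y < 2 * potential X) ->
  5 / 4 <= invmx (1%:M - X) i i <= 43.
Proof.
set m := invmx _ i i; move=> aX pX hX; have [hH _ _ _ X1] := aX.
have uX := potential_unitmx pX.
have scale s : 0 < s ->
    (forall x, 0 <= qform (1%:M - scalemx i s *m X *m scalemx i s) x) ->
    s ^+ 4 * (s ^+ 2 + (1 - s ^+ 2) * m) < 2.
  move=> s0 /(scalemx_admissible (gtr0_real s0) aX)/hX.
  by rewrite potential_scalemx // ltr_pM2r.
have rm : m \is Num.real.
  apply/CrealP; have /matrixP/(_ i i) := adj_invmx (herm1B hH).
  by rewrite !mxE.
have r34 : (3 / 4 : C) \is Num.real by rewrite realM ?realV ?realn.
have r43 : (4 / 3 : C) \is Num.real by rewrite realM ?realV ?realn.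
have n0 j : 0 < j.+1%:R :> C by rewrite ltr0n.
apply/andP; split.
  (* Doubling coordinate [i] keeps [X <= I] when [m <= 4/3]: [qform_inv_ge] with [c = 3/4] bounds
     the form at [y] below by [3 |x_i|^2], exactly what is lost. For larger [m] the bound [5/4] is
     immediate. *)
  have [m43|m43] := real_leP rm r43; last first.
    rewrite (le_trans _ (ltW m43)) // ler_pdivrMr ?n0 // mulrAC.
    by rewrite ler_pdivlMr ?n0 // -!natrM ler_nat.
  have : 2 ^+ 4 * (2 ^+ 2 + (1 - 2 ^+ 2) * m) < 2.
    apply: scale; rewrite ?n0 // => x.
    rewrite qform_scalemx ?realn //; set y := x *m _.
    have := qform_inv_ge y i (herm1B hH) X1 uX r34.
    rewrite mulmx_scalemx eqxx normrM exprMn normr_nat => h.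
    have -> : (1 - 2 ^+ 2) * `|x 0 i| ^+ 2 + qform (1%:M - X) y =
      qform (1%:M - X) y - 2 * (3 / 4) * (2 ^+ 2 * `|x 0 i| ^+ 2) +
        (3 / 4) ^+ 2 * m * (2 ^+ 2 * `|x 0 i| ^+ 2)
      + (4 / 3 - m) * (9 / 4 * `|x 0 i| ^+ 2) by field.
    by rewrite addr_ge0 // mulr_ge0 ?subr_ge0 // mulr_ge0 ?exprn_ge0 ?divr_ge0 ?ler0n.
  (* The comparison reads [16 (4 - 3 m) < 2], that is [m > 31/24]. *)
  rewrite -subr_gt0 => h; rewrite -subr_ge0.
  have -> : m - 5 / 4 = (2 - 2 ^+ 4 * (2 ^+ 2 + (1 - 2 ^+ 2) * m)) / 48 + 24^-1.
    by field.
  by rewrite addr_ge0 ?divr_ge0 ?invr_ge0 ?ler0n // ltW.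
(* Halving a coordinate always keeps [X <= I]; the comparison reads [m < 127/3]. *)
have : 2^-1 ^+ 4 * (2^-1 ^+ 2 + (1 - 2^-1 ^+ 2) * m) < 2.
  apply: scale; rewrite ?invr_gt0 ?n0 // => x.
  rewrite qform_scalemx ?realV ?realn // addr_ge0 // mulr_ge0 ?exprn_ge0 //.
  rewrite subr_ge0 exprVn invf_le1 ?exprn_gt0 // -natrX ler1n //.
rewrite -subr_gt0 => h; rewrite -subr_ge0.
have -> : 43 - m =
  (2 - 2^-1 ^+ 4 * (2^-1 ^+ 2 + (1 - 2^-1 ^+ 2) * m)) * (64 / 3) + 2 / 3.
  by field.
by rewrite addr_ge0 ?mulr_ge0 ?invr_ge0 ?ler0n // ltW.
Qed.

(** * The trace estimate *)

Lemma unitary_row_norm n (U : 'M[C]_n) i : U *m U^t* = 1%:M ->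
  \sum_j `|U i j| ^+ 2 = 1.
Proof.
move=> UU; transitivity ((U *m U^t*) i i); last by rewrite UU mxE eqxx.
by rewrite mxE; apply: eq_bigr => j _; rewrite !mxE normCK.
Qed.

Lemma unitary_congrE n (U : 'M[C]_n) (l : 'rV[C]_n) i j :
  (U^t* *m diag_mx l *m U) i j = \sum_t l 0 t * (U t i)^* * U t j.
Proof.
by rewrite mxE; apply: eq_bigr => t _; rewrite mul_mx_diag !mxE; congr (_ * _); rewrite mulrC.
Qed.

(** As the trace is 0, the trace norm is twice the sum of the positive eigenvalues, of which there
    are at most [k], each at most 1. *)
Lemma sum_norm_spectral k n (U : 'M[C]_n) (l : 'rV[C]_n) (X : 'M[C]_n) :
  U *m U^t* = 1%:M -> (forall i, l 0 i \is Num.real) -> (forall i, l 0 i <= 1) ->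
  X = U^t* *m diag_mx l *m U -> nonpos_codim k X -> (forall i, X i i = 0) ->
  \sum_t `|l 0 t| <= 2 * k%:R.
Proof.
move=> UU lr l1 eX kX X0.
have tr0 : \sum_t l 0 t = 0.
  rewrite -mxtrace_diag -[diag_mx l]mulmx1 -UU mulmxA mxtrace_mulC mulmxA -eX.
  by apply: big1 => i _; rewrite X0.
have -> : \sum_t `|l 0 t| = 2 * \sum_(t | 0 < l 0 t) l 0 t.
  transitivity (\sum_t (`|l 0 t| + l 0 t)); first by rewrite big_split /= tr0 addr0.
  rewrite mulr_sumr [RHS]big_mkcond.
  apply: eq_bigr => t _ /=; case: (real_ltP (real0 C) (lr t)) => lt.
    by rewrite gtr0_norm // mulr_natl mulr2n.
  by rewrite ler0_norm // addNr.
rewrite ler_pM2l // (@le_trans _ _ (\sum_(t | 0 < l 0 t) 1)) ?ler_sum //.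
rewrite sumr_const ler_nat -(cardsE (fun t => 0 < l 0 t)).
by apply: (card_pos_le UU); rewrite -eX.
Qed.

(* The Schur product of a form of norm rho and a PSD matrix M with diagonal at
   most c has norm at most rho * c; here it is paired with a matrix that the
   same unitary U diagonalizes. *)
Lemma schur_trace_bound n (U : 'M[C]_n) (l mu : 'rV[C]_n) (R : 'M[C]_n) rho c :
  U *m U^t* = 1%:M -> 0 <= rho ->
  (forall x, `|qform R x| <= rho * qform 1%:M x) ->
  (forall t, 0 <= mu 0 t) ->
  (forall i, (U^t* *m diag_mx mu *m U) i i <= c) ->
  `|\sum_i \sum_j R i j * (U^t* *m diag_mx mu *m U) i j
       * (U^t* *m diag_mx l *m U) j i| <= rho * c * \sum_t `|l 0 t|.
Proof.
move=> UU rho0 hR mu0 hc.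
(* Expanding both spectral decompositions turns the pairing into values of the form [R] at entrywise
   products of rows of [U]. *)
pose y a t : 'rV[C]_n := \row_i ((U a i)^* * U t i).
have -> : \sum_i \sum_j R i j * (U^t* *m diag_mx mu *m U) i j
       * (U^t* *m diag_mx l *m U) j i =
   \sum_t l 0 t * \sum_a mu 0 a * qform R (y a t).
  under eq_bigr => i _ do under eq_bigr => j _ do
    rewrite !unitary_congrE mulr_sumr.
  under [RHS]eq_bigr => t _ do rewrite mulr_sumr.
  under [RHS]eq_bigr => t _ do under eq_bigr => a _ do
    (rewrite qformE mulrA mulr_sumr; under eq_bigr => i _ do rewrite mulr_sumr).
  rewrite [RHS](eq_bigr (fun t => \sum_i \sum_a \sum_j
      l 0 t * mu 0 a * ((y a t) 0 i * R i j * ((y a t) 0 j)^*))); last first.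
    by move=> t _; rewrite exchange_big.
  rewrite [RHS]exchange_big; apply: eq_bigr => i _.
  rewrite exchange_big; apply: eq_bigr => t _.
  rewrite [RHS]exchange_big; apply: eq_bigr => j _.
  rewrite mulr_sumr mulr_suml; apply: eq_bigr => a _.
  by rewrite !mxE rmorphM /= conjCK; ring.
rewrite mulr_sumr (le_trans (ler_norm_sum _ _ _)) //; apply: ler_sum => t _.
rewrite normrM mulrC ler_wpM2r //.
apply: (@le_trans _ _ (\sum_a mu 0 a * (rho * \sum_i `|U a i| ^+ 2 * `|U t i| ^+ 2))).
  rewrite (le_trans (ler_norm_sum _ _ _)) //; apply: ler_sum => a _.
  rewrite normrM ger0_norm // ler_wpM2l // (le_trans (hR _)) //.
  rewrite qform1 ler_wpM2l // ler_sum // => i _.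
  by rewrite mxE normrM exprMn norm_conjC.
(* Summing over [a] first produces the diagonal entries, which are at most [c]. *)
have -> : \sum_a mu 0 a * (rho * \sum_i `|U a i| ^+ 2 * `|U t i| ^+ 2) =
  rho * \sum_i (U^t* *m diag_mx mu *m U) i i * `|U t i| ^+ 2.
  under eq_bigr => a _ do rewrite mulrCA mulr_sumr.
  rewrite -mulr_sumr exchange_big; congr (_ * _); apply: eq_bigr => i _.
  rewrite unitary_congrE mulr_suml; apply: eq_bigr => a _.
  by rewrite [in LHS]normCK; ring.
rewrite ler_wpM2l // (@le_trans _ _ (\sum_i c * `|U t i| ^+ 2)) //.
  by apply: ler_sum => i _; rewrite ler_wpM2r ?exprn_ge0.
by rewrite -mulr_sumr unitary_row_norm // mulr1.
Qed.

(** The trace argument for an arbitrary relation [b] with a norm bound; [c] and [rho] stand for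
    [1/p] and [sqrt p]. *)
Lemma codim_lower_bound k n (b : rel 'I_n) (A : 'M[C]_n) (c rho : C) :
  (forall x : C, 0 <= x -> exists m : nat, x < m%:R) ->
  A^t* = A -> (forall i, A i i = 0) -> (forall i j, b i j -> A i j = 0) ->
  nonpos_codim k A -> A \in unitmx -> 0 <= c -> 0 <= rho ->
  (forall x, `|qform (\matrix_(i, j) ((b i j)%:R - c)) x|
             <= rho * qform 1%:M x) ->
  c * n%:R <= 344 * rho * k%:R.
Proof.
move=> archi hA A0 Ab kA uA c0 rho0 hR.
have [X0 [aX0 pX0]] := admissible_start hA A0 Ab kA uA.
have [X [aX pX hX]] := near_maximal archi aX0 pX0.
have hm i := near_maximal_diag i aX pX hX.
have [hH Xd Xb kX X1] := aX; have uX := potential_unitmx pX.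
have [U [l [UU UU' lr eX]]] := herm_spectral hH.
have e1 : 1%:M - X = U^t* *m diag_mx (\row_i (1 - l 0 i)) *m U.
  rewrite -[X]scale1r {1}eX spectral_1B //; congr (_ *m diag_mx _ *m _).
  by apply/rowP => i; rewrite !mxE mul1r.
have l0 i : 0 <= 1 - l 0 i.
  have := X1 (row i U); rewrite e1 unitary_eigen //.
  by rewrite mxE.
have l1 i : 1 - l 0 i != 0.
  move: uX; rewrite unitmxE unitfE e1 det_unitary_congr // det_diag.
  by move=> /prodf_neq0/(_ i isT); rewrite mxE.
pose mu : 'rV[C]_n := \row_i (1 - l 0 i)^-1.
have eM : invmx (1%:M - X) = U^t* *m diag_mx mu *m U.
  apply: (can_inj (mulmxK uX)); rewrite mulVmx // e1 -!mulmxA.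
  rewrite [U *m (U^t* *m _)]mulmxA UU mul1mx [diag_mx mu *m _]mulmxA.
  have -> : diag_mx mu *m diag_mx (\row_i (1 - l 0 i)) = 1%:M.
    apply/matrixP => i j; rewrite mul_diag_mx !mxE.
    by case: eqP => [->|_]; rewrite ?mulr1n ?mulVf ?mulr0n ?mulr0.
  by rewrite mul1mx UU'.
have mu0 t : 0 <= mu 0 t by rewrite mxE invr_ge0.
set M := invmx (1%:M - X) in hm eM.
have hM i : (U^t* *m diag_mx mu *m U) i i <= 43.
  by rewrite -eM; case/andP: (hm i).
have := schur_trace_bound l UU rho0 hR mu0 hM.
rewrite -eX -eM.
have -> : \sum_i \sum_j (\matrix_(i, j) ((b i j)%:R - c)) i j * M i j * X j i
   = - (c * \tr (M *m X)).
  rewrite /mxtrace mulr_sumr -sumrN; apply: eq_bigr => i _.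
  rewrite mxE mulr_sumr -sumrN; apply: eq_bigr => j _; rewrite mxE.
  have [/Xb bij|_] := boolP (b i j); last by rewrite mulr0n; ring.
  have -> : X j i = 0 by move/matrixP/(_ j i): hH; rewrite !mxE bij conjC0.
  by rewrite !mulr0 oppr0.
have MX : M *m X = M - 1%:M.
  by rewrite -[in RHS](mulVmx uX) mulmxBr mulmx1 opprB addrC subrK.
have trM : n%:R / 4 <= \tr (M *m X).
  rewrite MX /mxtrace -[n in n%:R]card_ord -sumr_const mulr_suml.
  apply: ler_sum => i _; rewrite !mxE eqxx mulr1n lerBrDr.
  case/andP: (hm i) => + _; apply: le_trans.
  by rewrite le_eqVlt; apply/orP; left; apply/eqP; field.
have trM0 : 0 <= \tr (M *m X) by rewrite (le_trans _ trM) // divr_ge0 ?ler0n.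
rewrite normrN ger0_norm ?mulr_ge0 // => h.
have hl : \sum_t `|l 0 t| <= 2 * k%:R.
  apply: (sum_norm_spectral UU lr _ eX kX Xd) => i.
  by rewrite -subr_ge0.
(* Clearing the denominator gives [344 = 4 * 43 * 2]. *)
have : c * (n%:R / 4) <= rho * 43 * (2 * k%:R).
  rewrite (le_trans (ler_wpM2l c0 trM)) // (le_trans h) // ler_wpM2l //.
  by rewrite mulr_ge0 ?ler0n.
rewrite (mulrA c) ler_pdivrMr ?ltr0n // => /le_trans; apply.
by rewrite le_eqVlt; apply/orP; left; apply/eqP; ring.
Qed.

End HermitianForms.

(** * The polarity relation *)

(** Incidence of the point [x] with the line of slope [y.1] and intercept [- y.2]. *)
Definition polar (F : finFieldType) (x y : F * F) : bool :=
  x.1 * y.1 == x.2 + y.2.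

Section Polar.
Variables (F : finFieldType) (C : numClosedFieldType).
Local Notation q := (#|F|%:R : C).
Local Notation B u v := ((@polar F u v)%:R : C).

Lemma q_neq0 : q != 0.
Proof. by rewrite pnatr_eq0 -lt0n; apply/card_gt0P; exists 0. Qed.

Lemma sum_delta (I : finType) (i0 : I) (P : I -> C) :
  \sum_i (i == i0)%:R * P i = P i0.
Proof.
rewrite (bigD1 i0) //= eqxx mul1r big1 ?addr0 // => i /negbTE->.
by rewrite mul0r.
Qed.

Lemma polarE (c d : F) v : polar (c, d) v = (d == c * v.1 - v.2).
Proof. by rewrite /polar /= eq_sym [RHS]eq_sym subr_eq eq_sym. Qed.

Lemma polar_degree v : \sum_u B u v = q.
Proof.
rewrite -(pair_bigA _ (fun c d : F => B (c, d) v)) /=.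
under eq_bigr => c _.
  under eq_bigr => d _ do rewrite polarE -[_%:R]mulr1.
  rewrite (sum_delta _ (fun=> 1)); over.
by rewrite sumr_const.
Qed.

(** Lines of distinct slopes meet in one point; distinct parallel lines are disjoint; a line has [q]
    points. *)
Lemma polar_codegree v w :
  \sum_u B u v * B u w = q * (v == w)%:R - (v.1 == w.1)%:R + 1.
Proof.
rewrite -(pair_bigA _ (fun c d : F => B (c, d) v * B (c, d) w)) /=.
under eq_bigr => c _.
  under eq_bigr => d _ do rewrite !polarE.
  rewrite (sum_delta _ (fun d => (d == c * w.1 - w.2)%:R)).
  have -> : (c * v.1 - v.2 == c * w.1 - w.2) = (c * (v.1 - w.1) == v.2 - w.2).
    by rewrite -subr_eq0 -[RHS]subr_eq0; congr (_ == 0); ring.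
  over.
case: v w => [v1 v2] [w1 w2] /=; rewrite xpair_eqE.
have [<-|v1w1] /= := eqVneq v1 w1.
  under eq_bigr => c _ do rewrite subrr mulr0 eq_sym subr_eq0.
  by rewrite sumr_const subrK mulr_natl.
have v1w1' : v1 - w1 != 0 by rewrite subr_eq0.
under eq_bigr => c _.
  have -> : (c * (v1 - w1) == v2 - w2) = (c == (v2 - w2) / (v1 - w1)).
    by rewrite -[in LHS](divfK v1w1' (v2 - w2)) (inj_eq (mulIf v1w1')).
  rewrite -[_%:R]mulr1; over.
by rewrite (sum_delta _ (fun=> 1)) mulr0 subr0 add0r.
Qed.

(** Subtracting [1/q] cancels the constant term of the codegree. What is left is [q I] minus a
    positive semidefinite block matrix. *)
Lemma polar_kernel v w :
  \sum_u (B u v - q^-1) * (B u w - q^-1) = q * (v == w)%:R - (v.1 == w.1)%:R.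
Proof.
transitivity (\sum_u B u v * B u w - q^-1 * \sum_u B u v
   - q^-1 * \sum_u B u w + \sum_(u : F * F) q^-1 ^+ 2).
  rewrite !mulr_sumr -!sumrB -big_split; apply: eq_bigr => u _ /=; ring.
rewrite polar_codegree !polar_degree mulVf ?q_neq0 // sumr_const card_prod.
by rewrite -[_ ^+ 2 *+ _]mulr_natl natrM; field; exact: q_neq0.
Qed.

Lemma normsq_sum (I : finType) (P : pred I) (a : I -> C) :
  `|\sum_(j | P j) a j| ^+ 2 = \sum_(j | P j) \sum_(l | P l) a j * (a l)^*.
Proof.
rewrite normCK rmorph_sum mulr_suml; apply: eq_bigr => j _.
by rewrite mulr_sumr.
Qed.

(** Let [w] range over all of [F * F], not only the image of [g], so that [polar_kernel] applies:
    the squared norm of [w] is [q |x|^2] minus one square for each first coordinate. Cauchy-Schwarz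
    finishes. *)
Lemma polar_qform r (g : 'I_r -> F * F) (x : 'rV[C]_r) (s : C) :
  injective g -> 0 < s -> s ^+ 2 = q ->
  `|qform (\matrix_(i, j) (B (g i) (g j) - q^-1)) x| <= s * qform 1%:M x.
Proof.
move=> gI s0 s2; rewrite qform1.
pose w u := \sum_j (B u (g j) - q^-1) * (x 0 j)^*.
have -> : qform (\matrix_(i, j) (B (g i) (g j) - q^-1)) x =
  \sum_i x 0 i * w (g i).
  rewrite qformE; apply: eq_bigr => i _; rewrite mulr_sumr.
  by apply: eq_bigr => j _; rewrite mxE mulrA.
have w2 : \sum_u `|w u| ^+ 2 <= q * \sum_i `|x 0 i| ^+ 2.
  have -> : \sum_u `|w u| ^+ 2 = \sum_j \sum_l (x 0 j)^* * x 0 l *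
      \sum_u (B u (g j) - q^-1) * (B u (g l) - q^-1).
    under eq_bigr => u _ do rewrite normsq_sum.
    rewrite exchange_big; apply: eq_bigr => j _.
    rewrite exchange_big; apply: eq_bigr => l _; rewrite mulr_sumr.
    apply: eq_bigr => u _ /=.
    rewrite rmorphM /= conjCK rmorphB /= fmorphV /= !conjC_nat; ring.
  have -> : \sum_j \sum_l (x 0 j)^* * x 0 l *
      \sum_u (B u (g j) - q^-1) * (B u (g l) - q^-1) =
    q * \sum_i `|x 0 i| ^+ 2 -
      \sum_(a : F) `|\sum_(j | (g j).1 == a) (x 0 j)^*| ^+ 2.
    have -> : \sum_(a : F) `|\sum_(j | (g j).1 == a) (x 0 j)^*| ^+ 2 =
       \sum_j \sum_l (x 0 j)^* * x 0 l * ((g j).1 == (g l).1)%:R.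
      under eq_bigr => a _ do rewrite normsq_sum big_mkcond.
      rewrite exchange_big; apply: eq_bigr => j _.
      rewrite -big_mkcond (big_pred1 (g j).1) => [|a]; last exact: eq_sym.
      rewrite big_mkcond; apply: eq_bigr => l _.
      by rewrite conjCK eq_sym; case: eqP; rewrite ?mulr1 ?mulr0.
    rewrite mulr_sumr -sumrB; apply: eq_bigr => j _.
    rewrite normCK [x 0 j * _]mulrC.
    have -> : q * ((x 0 j)^* * x 0 j) =
        \sum_l (l == j)%:R * (q * ((x 0 j)^* * x 0 l)) by rewrite sum_delta.
    rewrite -sumrB; apply: eq_bigr => l _.
    by rewrite polar_kernel (inj_eq gI) [l == j]eq_sym; ring.
  by rewrite gerBl sumr_ge0 // => a _; rewrite exprn_ge0.
rewrite (le_trans (ler_norm_sum _ _ _)) //.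
(* Cauchy-Schwarz as a weighted mean inequality; the weight [s] balances the two terms because
   [|w|^2 <= s^2 |x|^2]. *)
have amgm (a b : C) : 0 <= a -> 0 <= b -> a * b <= (s * a ^+ 2 + b ^+ 2 / s) / 2.
  move=> a0 b0; rewrite -subr_ge0.
  have -> : (s * a ^+ 2 + b ^+ 2 / s) / 2 - a * b = (s * a - b) ^+ 2 / (2 * s).
    by field; rewrite gt_eqF.
  apply: divr_ge0; last by rewrite mulr_ge0 ?(ltW s0) ?ler0n.
  rewrite real_exprn_even_ge0 //.
  by rewrite realB ?ger0_real ?mulr_ge0 // ltW.
have h1 : \sum_i `|x 0 i * w (g i)| <=
    (s * \sum_i `|x 0 i| ^+ 2 + (\sum_i `|w (g i)| ^+ 2) / s) / 2.
  rewrite mulr_sumr mulr_suml -big_split mulr_suml /=; apply: ler_sum => i _.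
  by rewrite normrM amgm.
have h2 : \sum_i `|w (g i)| ^+ 2 <= \sum_u `|w u| ^+ 2.
  rewrite -(big_imset (fun u => `|w u| ^+ 2) (in2W gI : {in predT &, injective g})).
  rewrite [X in _ <= X](bigID [in g @: predT]) /= lerDl.
  by apply: sumr_ge0 => u _; rewrite exprn_ge0.
rewrite (le_trans h1) // ler_pdivrMr ?ltr0n //.
have -> : s * (\sum_i `|x 0 i| ^+ 2) * 2 =
   s * (\sum_i `|x 0 i| ^+ 2) + q * (\sum_i `|x 0 i| ^+ 2) / s.
  by rewrite -s2; field; rewrite gt_eqF.
by rewrite lerD2l ler_pM2r ?invr_gt0 // (le_trans h2).
Qed.
End Polar.

(** * Haemers' bound *)

(** The factorization through ['I_m] bounds the rank of the matrix by [m], hence that of its [k]-th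
    tensor power by [m ^ k]. On an independent set the tensor power is diagonal and invertible. *)
Lemma alpha_strong_pow_le (T : finType) (F : fieldType) m (e : rel T)
    (phi psi : T -> 'I_m -> F) k :
  (forall x, \sum_l phi x l * psi x l != 0) ->
  (forall x y, x != y -> ~~ e x y -> \sum_l phi x l * psi y l = 0) ->
  (alpha (strong_pow e k) <= m ^ k)%N.
Proof.
move=> h1 h2; apply/bigmax_leqP => S /forall_inP indS.
pose v (a : 'I_#|S|) : {ffun 'I_k -> T} := enum_val a.
pose L := {ffun 'I_k -> 'I_m}.
pose P : 'M[F]_(#|S|, #|L|) :=
  \matrix_(a, c) \prod_i phi (v a i) ((enum_val c : L) i).
pose Q : 'M[F]_(#|L|, #|S|) :=
  \matrix_(c, a) \prod_i psi (v a i) ((enum_val c : L) i).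
have PQ a b : (P *m Q) a b = \prod_i \sum_l phi (v a i) l * psi (v b i) l.
  rewrite bigA_distr_bigA mxE (reindex _ (onW_bij _ (enum_val_bij L))) /=.
  by apply: eq_bigr => c _; rewrite !mxE big_split.
have : P *m Q \in unitmx.
  have -> : P *m Q = diag_mx (\row_a (P *m Q) a a).
    apply/matrixP => a b; rewrite [RHS]mxE [X in X *+ _]mxE.
    have [->|ab] := eqVneq a b; first by rewrite mulr1n.
    have vab : v a != v b by rewrite (inj_eq enum_val_inj).
    (* Distinct nonadjacent words have a coordinate with distinct nonadjacent letters, and its
       factor vanishes. *)
    have /forall_inP/(_ (v b) (enum_valP b)) := indS (v a) (enum_valP a).
    rewrite /strong_pow vab /= negb_forall mulr0n.
    case/existsP => i; rewrite negb_or => /andP[ui ei].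
    by rewrite PQ (bigD1 i) //= h2 ?mul0r.
  rewrite unitmxE unitfE det_diag; apply/prodf_neq0 => a _.
  by rewrite mxE PQ; apply/prodf_neq0.
move/mxrank_unit => rk; rewrite -rk (leq_trans (mxrankM_maxl _ _)) //.
by rewrite (leq_trans (rank_leq_col _)) // card_ffun !card_ord.
Qed.

Lemma Rpower_root_le (a k : nat) (x : R) : (0 < k)%N -> 1 <= x ->
  a%:R <= x ^+ k -> Rpower (INR a) (Rinv (INR k)) <= x.
Proof.
move=> k0 x1; rewrite -INRE => axk.
have kR : Rlt 0 (INR k) by apply: lt_0_INR; apply/ssrnat.ltP.
have xR : Rlt 0 x by apply/RltP; rewrite (lt_le_trans _ x1).
apply/RleP; case: a axk => [_|a axk].
  (* [ln 0] is 0 by default, so this power of 0 is 1; hence the hypothesis [1 <= x]. *)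
  suff -> : Rpower (INR 0) (/ INR k) = Rdefinitions.IZR 1 by apply/RleP.
  rewrite /Rpower /ln /=; case: Rlt_dec => [/Rlt_irrefl //|_].
  by rewrite Rmult_0_r exp_0.
have -> : x = Rpower (x ^+ k) (/ INR k).
  rewrite -RpowE -Rpower_pow // Rpower_mult Rinv_r ?Rpower_1 //.
  exact: Rgt_not_eq.
apply: Rle_Rpower_l.
  by apply: Rlt_le; apply: Rinv_0_lt_compat.
by split; [apply: lt_0_INR; apply/ssrnat.ltP | apply/RleP].
Qed.

Lemma shannon_capacity_le (T : finType) (e : rel T) (m : nat) : (0 < m)%N ->
  (forall k, (0 < k)%N -> (alpha (strong_pow e k) <= m ^ k)%N) ->
  shannon_capacity e <= m%:R.
Proof.
move=> m0 h; apply: ge_sup.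
  by exists (Rpower (INR (alpha (strong_pow e 1))) (Rinv (INR 1))), 1%N.
by move=> _ [k [k0 ->]]; apply: Rpower_root_le; rewrite // ?ler1n // -natrX ler_nat h.
Qed.

(** * The graphs *)

Local Notation C := R[i].

Definition nonabsolute (F : finFieldType) : {set F * F} :=
  [set x | ~~ polar x x].

Definition antipolar (F : finFieldType) : rel 'I_#|nonabsolute F| :=
  fun i j => (i != j) && ~~ polar (enum_val i) (enum_val j).

Lemma polar_sym (F : finFieldType) (x y : F * F) : polar x y = polar y x.
Proof. by rewrite /polar mulrC [y.2 + _]addrC. Qed.

Lemma antipolar_simple (F : finFieldType) : simple_graph (@antipolar F).
Proof.
split=> [i j|i]; first by rewrite /antipolar eq_sym polar_sym.
by rewrite /antipolar eqxx.
Qed.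

Lemma antipolar_shannon (F : finFieldType) :
  shannon_capacity (@antipolar F) <= 3%:R.
Proof.
apply: shannon_capacity_le => // k _.
(* Rank 3 factorization [x.1 * y.1 + (- x.2) * 1 + 1 * (- y.2)]. *)
pose phi (i : 'I_#|nonabsolute F|) (l : 'I_3) : F :=
  [:: (enum_val i).1; - (enum_val i).2; 1]`_l.
pose psi (i : 'I_#|nonabsolute F|) (l : 'I_3) : F :=
  [:: (enum_val i).1; 1; - (enum_val i).2]`_l.
have E i j : \sum_l phi i l * psi j l =
    (enum_val i).1 * (enum_val j).1 - ((enum_val i).2 + (enum_val j).2).
  by rewrite !big_ord_recl big_ord0 /phi /psi /=; ring.
apply: (@alpha_strong_pow_le _ F 3 _ phi psi) => [i|i j ij].
  by rewrite E subr_eq0; have := enum_valP i; rewrite inE.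
by rewrite /antipolar ij negbK => /eqP; rewrite E => ->; rewrite subrr.
Qed.

(** A removed point satisfies [a^2 = 2 b]; as 2 is invertible, [a] determines it, so at most [q]
    points are removed. *)
Lemma card_nonabsolute (F : finFieldType) : 2%:R != 0 :> F ->
  (#|F| ^ 2 - #|F| <= #|nonabsolute F| <= #|F| ^ 2)%N.
Proof.
move=> F2; have cT : #|{: F * F}| = (#|F| ^ 2)%N by rewrite card_prod.
rewrite -cT max_card andbT leq_subLR -(cardsC (nonabsolute F)) addnC leq_add2r.
have inj : {in ~: nonabsolute F &, injective (@fst F F)}.
  move=> [a b] [c d]; rewrite !inE !negbK /polar /= => /eqP h1 /eqP + e.
  have two z : z + z = 2%:R * z :> F by rewrite mulr_natl mulr2n.
  by rewrite -{}e h1 !two => /(mulfI F2) ->.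
by rewrite -(card_in_imset inj) max_card.
Qed.

(** * The inertia bound for the graphs *)

Lemma complex_archi (x : C) : 0 <= x -> exists m : nat, x < m%:R.
Proof.
move=> x0; exists (Num.bound (complex.Re x)).
rewrite -(RRe_real (ger0_real x0)) -(rmorph_nat (real_complex R)) ltcR /=.
by apply: archi_boundP; rewrite -ler0c (RRe_real (ger0_real x0)).
Qed.

Lemma antipolar_inertia (F : finFieldType) (A : 'M[C]_#|nonabsolute F|) (s : R) :
  weighted_adj (@antipolar F) A -> 0 < s -> s ^+ 2 = #|F|%:R ->
  #|nonabsolute F|%:R <= 345 * s ^+ 3 * (n_nonneg A)%:R :> R.
Proof.
case=> hA Ae s0 s2.
have hA' : A^t* = A by apply/matrixP => i j; rewrite !mxE hA conjCK.
have A0 i : A i i = 0.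
  by apply/eqP; apply: contraT => /Ae; rewrite /antipolar eqxx.
have [kA rA] : nonpos_codim (n_nonneg A) A /\
    (#|nonabsolute F| - \rank A <= n_nonneg A)%N.
  apply: nonneg_roots_codim => //; rewrite /eigenvalues.
  case: closed_field_poly_normal => r /= {1}->.
  by rewrite (monicP (char_poly_monic A)) scale1r.
have [f fI fu] := herm_principal_unit hA'.
set k := n_nonneg A in kA rA *.
(* A principal submatrix is a congruence of [A], so it inherits [nonpos_codim]. *)
have fE : mxsub f f A = rowsub f 1%:M *m A *m (rowsub f 1%:M)^t*.
  rewrite -rowsubE; apply/matrixP => i j; rewrite !mxE (bigD1 (f j)) //=.
  rewrite !mxE eqxx conjC1 mulr1 big1 ?addr0 // => l lj.
  by rewrite !mxE eq_sym (negbTE lj) conjC0 mulr0.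
pose g i : F * F := enum_val (f i).
have gI : injective g by move=> i j /enum_val_inj/fI.
have sC : (s%:C)%C ^+ 2 = #|F|%:R :> C by rewrite -rmorphXn s2 rmorph_nat.
have h : #|F|%:R^-1 * (\rank A)%:R <= 344 * (s%:C)%C * k%:R :> C.
  apply: (@codim_lower_bound _ k _ (fun i j => polar (g i) (g j)) (mxsub f f A)).
  - exact: complex_archi.
  - by rewrite fE !adjmxM hA' trmxCK mulmxA.
  - by move=> i; rewrite mxE.
  - move=> i j ij; rewrite mxE; apply/eqP; apply: contraT => /Ae.
    by rewrite /antipolar ij andbF.
  - by rewrite fE; apply: nonpos_codim_congr.
  - exact: fu.
  - by rewrite invr_ge0 ler0n.
  - by rewrite ler0c ltW.
  - by move=> x; apply: polar_qform => //; rewrite ltcR.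
have q0 : 0 < #|F|%:R :> R by rewrite -s2 exprn_gt0.
have h' : (\rank A)%:R <= 344 * s ^+ 3 * k%:R :> R.
  rewrite -lecR 2!rmorphM rmorphXn !rmorph_nat /=.
  have q0C : 0 < #|F|%:R :> C by rewrite -(rmorph_nat (real_complex R)) ltcR.
  move: h; rewrite mulrC ler_pdivrMr // -sC => /le_trans; apply.
  by rewrite le_eqVlt; apply/orP; left; apply/eqP; ring.
(* The rank deficiency, at most [k], is absorbed as [k <= s^3 k], which turns 344 into 345. *)
have s1 : 1 <= s ^+ 3.
  rewrite exprn_ege1 // -(@expr_ge1 _ 2) ?(ltW s0) // s2 ler1n.
  by rewrite -(ltr0n R).
have : #|nonabsolute F|%:R <= (\rank A)%:R + k%:R :> R.
  by rewrite -natrD ler_nat -leq_subLR.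
have k0 : 0 <= k%:R :> R := ler0n _ _.
move=> hn; rewrite (le_trans hn) // -subr_ge0.
have -> : 345 * s ^+ 3 * k%:R - ((\rank A)%:R + k%:R) =
  (344 * s ^+ 3 * k%:R - (\rank A)%:R) + (s ^+ 3 - 1) * k%:R :> R by ring.
by rewrite addr_ge0 ?subr_ge0 // mulr_ge0 ?subr_ge0.
Qed.

Lemma Fp_two_neq0 (p : nat) : prime p -> (2 < p)%N -> 2%:R != 0 :> 'F_p.
Proof.
move=> pp p2; rewrite -(dvdn_pcharf (pchar_Fp pp)).
by apply/negP => /(dvdn_leq (isT : 0 < 2)%N); rewrite leqNgt p2.
Qed.

Lemma antipolar_Fp (p : nat) : prime p -> (2 < p)%N ->
  exists H : rel 'I_#|nonabsolute 'F_p|,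
    [/\ simple_graph H, shannon_capacity H <= 3%:R &
    1000^-1 * Rpower (INR #|nonabsolute 'F_p|) (Rinv 12)
      <= INR (n_nonneg_graph H)].
Proof.
move=> pp p2; exists (@antipolar 'F_p).
split; [exact: antipolar_simple | exact: antipolar_shannon |].
rewrite /n_nonneg_graph; case: ex_minnP => k /asboolP[A [wA <-]] _.
have F2 := Fp_two_neq0 pp p2.
have /andP[n1 n2] := card_nonabsolute F2.
rewrite card_Fp // in n1 n2; set n := #|_| in n1 n2 *.
pose s : R := Num.sqrt p%:R.
have s2 : s ^+ 2 = p%:R by rewrite sqr_sqrtr ?ler0n.
have s0 : 0 < s by rewrite sqrtr_gt0 ltr0n prime_gt0.
have := antipolar_inertia wA s0; rewrite card_Fp // => /(_ s2).
rewrite -/n (INRE (n_nonneg A)); set K := (n_nonneg A)%:R => hK.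
have s1 : 1 <= s by rewrite -(@expr_ge1 _ 2) ?(ltW s0) // s2 ler1n prime_gt0.
have p3 : 3 <= s ^+ 2 by rewrite s2 ler_nat.
(* Holds with room to spare: [n <= p^2 = s^4 <= s^12]. *)
have hR : Rpower (INR n) (Rinv 12) <= s.
  have -> : Rdefinitions.IZR 12 = INR 12 by rewrite INR_IZR_INZ.
  apply: Rpower_root_le => //.
  apply: (@le_trans _ _ (s ^+ 4)); last by apply: ler_weXn2l.
  by rewrite (exprM s 2 2) s2 -natrX ler_nat.
have n1R : s ^+ 4 - s ^+ 2 <= n%:R.
  rewrite (exprM s 2 2) s2 -natrX -natrB ?ler_nat //.
  by rewrite -{1}[p]expn1 leq_pexp2l ?prime_gt0.
have K0 : 0 <= K := ler0n _ _.
(* From [s^2 = p >= 3], [n >= s^4 - s^2 >= (2/3) s^4]. Dividing by [s^3] leaves [K >= (2/1035) s],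
   and [2/1035 > 1/1000]. *)
have : 2 / 3 * s ^+ 4 <= 345 * s ^+ 3 * K.
  rewrite (le_trans _ hK) // (le_trans _ n1R) // -subr_ge0.
  have -> : s ^+ 4 - s ^+ 2 - 2 / 3 * s ^+ 4 = s ^+ 2 * (s ^+ 2 - 3) / 3 by field.
  by rewrite divr_ge0 ?ler0n // mulr_ge0 ?exprn_ge0 ?subr_ge0 // ltW.
have s3 : 0 < s ^+ 3 by rewrite exprn_gt0.
have -> : 2 / 3 * s ^+ 4 = s ^+ 3 * (2 / 3 * s) by ring.
have -> : 345 * s ^+ 3 * K = s ^+ 3 * (345 * K) by ring.
have fin (w x y : R) : w <= x -> 0 <= y -> 2 / 3 * x <= 345 * y ->
  1000^-1 * w <= y by move=> *; lra.
by rewrite ler_pM2l // => h; exact: fin hR K0 h.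
Qed.

Theorem theorem1p8 :
  exists (c : R) (N : nat -> Prop) (H : forall n : nat, rel 'I_n),
    (0 < c)%R /\
    (forall n, N n -> (0 < n)%N) /\
    (forall m : nat, exists n, (m < n)%N /\ N n) /\
    (forall n, N n ->
       simple_graph (H n) /\
       (shannon_capacity (H n) <= 3)%R /\
       (c * Rpower (INR n) (Rinv 12) <= INR (n_nonneg_graph (H n)))%R).
Proof.
(* [N] collects all orders for which a suitable graph exists; choice then supplies [H n], with an
   arbitrary relation outside [N]. *)
pose N n := exists H : rel 'I_n, (0 < n)%N /\
  [/\ simple_graph H, shannon_capacity H <= 3%:R &
    1000^-1 * Rpower (INR n) (Rinv 12) <= INR (n_nonneg_graph H)].
have pick n : exists H : rel 'I_n, N n ->
    [/\ simple_graph H, shannon_capacity H <= 3%:R &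
      1000^-1 * Rpower (INR n) (Rinv 12) <= INR (n_nonneg_graph H)].
  have [[H [_ hH]]|nN] := pselect (N n); first by exists H.
  by exists (fun _ _ => false).
exists 1000^-1, N, (fun n => sval (cid (pick n))); split.
  by rewrite invr_gt0 ltr0n.
split; first by move=> n [H []].
split=> [m|n Nn]; last by case: (svalP (cid (pick n)) Nn).
have [p mp pp] := prime_above (maxn m 2).
rewrite gtn_max in mp; case/andP: mp => mp p2.
have [H hH] := antipolar_Fp pp p2.
have F2 := Fp_two_neq0 pp p2.
have /andP[n1 _] := card_nonabsolute F2; rewrite card_Fp // in n1.
(* Infinitude of [N]: the order is at least [p^2 - p >= p > m]. *)
have pp2 : (p + p <= p ^ 2)%N.
  by rewrite addnn -mul2n -mulnn leq_mul2r (ltnW p2) orbT.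
have mn : (m < #|nonabsolute 'F_p|)%N.
  apply: (leq_trans mp); apply: leq_trans n1.
  by rewrite leq_subRL // (leq_trans (leq_addr _ _) pp2).
by exists #|nonabsolute 'F_p|; split=> //; exists H; split=> //; apply: leq_ltn_trans mn.
Qed.
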